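(* Let $V$ be a vector space over a field $K$. The ring of all endomorphisms $\varphi$ of $V$ such that every subspace $H\le V$ has finite codimension in $H+\varphi(H)$ is the sum of the ring of scalar multiplications of $V$ and the ring of finitary endomorphisms of $V$.
   Context: ''Endomorphism of $V$'' means $K$-linear endomorphism. A scalar multiplication is a map $v\mapsto kv$ with $k\in K$ fixed. An endomorphism of a vector space is called finitary if its image is finite-dimensional. The sum is taken in the additive group of the endomorphism ring of $V$. *)

(* Defs.v *)
From HB Require Import structures.
From mathcomp Require Import all_boot all_algebra.
From mathcomp Require Import all_classical.

Set Implicit Arguments.
Unset Strict Implicit.
Unset Printing Implicit Defensive.

Import GRing.Theory.
Local Open Scope classical_set_scope.
Local Open Scope ring_scope.

(* The endomorphism ring of V, with pointwise addition and with composition as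
   multiplication. V may be 0, so in general it is only a pzRingType. *)
Definition lend (K : fieldType) (V : lmodType K) : Type := {linear V -> V}.

Section EndomorphismRing.
Context (K : fieldType) (V : lmodType K).
Implicit Types f g h : lend V.

Lemma lendP f g : (forall v, f v = g v) -> f = g.
Proof.
case: f g => [f [[cf] [sf]]] [g [[cg] [sg]]] /= /funext efg; subst g.
by rewrite (Prop_irrelevance cf cg) (Prop_irrelevance sf sg).
Qed.

Definition lend_zero : lend V := \0.
Definition lend_opp f : lend V := \- f.
Definition lend_add f g : lend V := f \+ g.
Definition lend_one : lend V := idfun.
Definition lend_mul f g : lend V := f \o g.

Fact lend_addA : associative lend_add.
Proof. by move=> f g h; apply: lendP => v /=; rewrite addrA. Qed.
Fact lend_addC : commutative lend_add.
Proof. by move=> f g; apply: lendP => v /=; rewrite addrC. Qed.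
Fact lend_add0 : left_id lend_zero lend_add.
Proof. by move=> f; apply: lendP => v /=; rewrite add0r. Qed.
Fact lend_addN : left_inverse lend_zero lend_opp lend_add.
Proof. by move=> f; apply: lendP => v /=; rewrite addNr. Qed.
Fact lend_mulA : associative lend_mul.
Proof. by move=> f g h; apply: lendP. Qed.
Fact lend_mul1 : left_id lend_one lend_mul.
Proof. by move=> f; apply: lendP. Qed.
Fact lend_mulr1 : right_id lend_one lend_mul.
Proof. by move=> f; apply: lendP. Qed.
Fact lend_mulDl : left_distributive lend_mul lend_add.
Proof. by move=> f g h; apply: lendP. Qed.
Fact lend_mulDr : right_distributive lend_mul lend_add.
Proof. by move=> f g h; apply: lendP => v /=; rewrite raddfD. Qed.

HB.instance Definition _ := gen_eqMixin (lend V).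
HB.instance Definition _ := gen_choiceMixin (lend V).
HB.instance Definition _ := GRing.isZmodule.Build (lend V)
  lend_addA lend_addC lend_add0 lend_addN.
HB.instance Definition _ := GRing.Zmodule_isPzRing.Build (lend V)
  lend_mulA lend_mul1 lend_mulr1 lend_mulDl lend_mulDr.

Lemma lend_addE f g v : (f + g) v = f v + g v. Proof. by []. Qed.
Lemma lend_oppE f v : (- f) v = - f v. Proof. by []. Qed.
Lemma lend_zeroE v : (0 : lend V) v = 0. Proof. by []. Qed.
Lemma lend_oneE v : (1 : lend V) v = v. Proof. by []. Qed.
Lemma lend_mulE f g v : (f * g) v = f (g v). Proof. by []. Qed.

End EndomorphismRing.

Definition set_add (A : zmodType) (X Y : set A) : set A :=
  [set x + y | x in X & y in Y].

(* A subring without the requirement that it contain 1: the finitary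
   endomorphisms contain the identity only when V is finite-dimensional. *)
Definition rng_closed (R : pzRingType) (S : {pred R}) : Prop :=
  GRing.zmod_closed S /\ GRing.mulr_2closed S.

Section Endomorphisms.
Context (K : fieldType) (V : lmodType K).
Implicit Types (H W : set V) (f : lend V).

Definition subspace H : Prop := GRing.submod_closed (mem H).

Definition lspan (s : seq V) : set V :=
  [set v | exists c : 'I_(size s) -> K, v = \sum_(i < size s) c i *: s`_i].

Definition finite_dim W : Prop := exists s : seq V, W = lspan s.

(* For subspaces H <= W: W / H is finite-dimensional, that is, W / H is spanned
   by the classes of finitely many vectors of W. *)
Definition finite_codim H W : Prop :=
  exists s : seq V, W = set_add H (lspan s).

Definition almost_preserving : set (lend V) :=
  [set f | forall H, subspace H -> finite_codim H (set_add H (f @` H))].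

Definition scalar_mults : set (lend V) :=
  [set f | exists k : K, forall v, f v = k *: v].

Definition finitary : set (lend V) := [set f | finite_dim (range f)].

End Endomorphisms.

Arguments almost_preserving {K} V.
Arguments scalar_mults {K} V.
Arguments finitary {K} V.

(* Main.v *)
Require Import Defs.
From mathcomp Require Import all_boot all_algebra.
From mathcomp Require Import all_classical.

(** If [f = k + g] with [g] finitary, then [H + f H = H + g H] for every subspace
[H], and [g H] is finite-dimensional; so [f] is almost preserving. Finitary
endomorphisms absorb composition on both sides, so scalars plus finitary
endomorphisms form a ring; by the equality this is also the ring of almost
preserving endomorphisms.

The converse rests on a dichotomy ([scalar_add_finitary_or_escape]). Fix a
finite-dimensional subspace [W]. Either some [v] has [v] and [f v] linearly
independent modulo [W], or every [v] outside [W] is an eigenvector of [f] modulo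
[W]. In the second case all the eigenvalues agree
([eigenvalue_mod_unique]), provided that [V / W] has dimension at least 2, so
[f - k] maps [V] into [W] for some scalar [k]; when [V / W] is smaller, [V]
itself is finite-dimensional and [f] is finitary.

If [f] is not a scalar plus a finitary endomorphism, the first case therefore
occurs for every [W], which yields vectors [v_0, v_1, ...] such that all the
[v_i] and [f v_i] together are linearly independent. The span [H] of the [v_i]
then has infinite codimension in [H + f H]
([escape_not_almost_preserving]). *)

Set Implicit Arguments.
Unset Strict Implicit.
Unset Printing Implicit Defensive.

Import GRing.Theory.
Local Open Scope classical_set_scope.
Local Open Scope ring_scope.

(** * Subspaces and spans of finite lists *)

Section Subspaces.
Context (K : fieldType) (V : lmodType K).
Implicit Types (H W : set V) (s t : seq V) (a : K) (u v x y : V).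

(** Trades boolean membership in the set for plain application, the form in
which the set is used from here on. *)
Lemma subspaceP H :
  subspace H <-> H 0 /\ (forall a x y, H x -> H y -> H (a *: x + y)).
Proof.
split=> [[H0 Hl]|[H0 Hl]].
  by split=> [|a x y Hx Hy]; [exact: set_mem H0|
    by apply: set_mem; apply: Hl; exact: mem_set].
by split=> [|a x y /set_mem Hx /set_mem Hy]; apply: mem_set => //; exact: Hl.
Qed.

Lemma subspace0 H : subspace H -> H 0.
Proof. by case/subspaceP. Qed.

Lemma subspaceZ H a x : subspace H -> H x -> H (a *: x).
Proof. by case/subspaceP=> H0 Hl Hx; rewrite -[_ *: _]addr0; apply: Hl. Qed.

Lemma subspaceD H x y : subspace H -> H x -> H y -> H (x + y).
Proof. by case/subspaceP=> _ Hl Hx Hy; rewrite -[x]scale1r; apply: Hl. Qed.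

Lemma subspaceB H x y : subspace H -> H x -> H y -> H (x - y).
Proof.
by move=> sH Hx Hy; rewrite -scaleN1r; apply: subspaceD => //; exact: subspaceZ.
Qed.

Lemma subspaceZK H a x : subspace H -> a != 0 -> H (a *: x) -> H x.
Proof. by move=> sH a0 /(subspaceZ a^-1 sH); rewrite scalerK. Qed.

Lemma subspace_range (f : lend V) H : subspace H -> subspace (f @` H).
Proof.
move=> sH; apply/subspaceP; split.
  by exists 0; [exact: subspace0|exact: linear0].
move=> a _ _ [x Hx <-] [y Hy <-]; exists (a *: x + y); last exact: linearP.
by apply: subspaceD => //; exact: subspaceZ.
Qed.

Lemma subspaceI H W : subspace H -> subspace W -> subspace (H `&` W).
Proof.
move=> sH sW; apply/subspaceP; split; first by split; exact: subspace0.
by move=> a x y [Hx Wx] [Hy Wy]; split; apply: subspaceD => //; exact: subspaceZ.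
Qed.

Lemma subspaceT : subspace [set: V].
Proof. exact/subspaceP. Qed.

Lemma lspan_nil x : lspan [::] x <-> x = 0.
Proof.
split=> [[c ->]|->]; first by rewrite big_ord0.
by exists (fun=> 0); rewrite big_ord0.
Qed.

(** Peeling off one generator at a time replaces the indexed sum by an induction
on the list; membership in [lspan (v :: s)] is also how dependence on [v]
modulo [lspan s] is expressed below. *)
Lemma lspan_cons v s x : lspan (v :: s) x <-> exists a, lspan s (x - a *: v).
Proof.
split=> [[c ->]|[a [c e]]].
  exists (c ord0), (fun i => c (lift ord0 i)).
  by rewrite big_ord_recl addrC addKr; apply: eq_bigr.
exists (fun i : 'I_(size s).+1 => oapp c a (unlift ord0 i)).
rewrite big_ord_recl unlift_none /=.
under eq_bigr do rewrite liftK /=.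
by rewrite -e addrC subrK.
Qed.

Lemma subspace_lspan s : subspace (lspan s).
Proof.
elim: s => [|v s /subspaceP[s0 sl]]; apply/subspaceP; split.
- exact/lspan_nil.
- by move=> a x y /lspan_nil-> /lspan_nil->; apply/lspan_nil; rewrite scaler0 addr0.
- by apply/lspan_cons; exists 0; rewrite scale0r subr0.
move=> a x y /lspan_cons[b xs] /lspan_cons[c ys]; apply/lspan_cons.
exists (a * b + c); rewrite scalerDl -scalerA opprD addrACA -scalerBr.
exact: sl.
Qed.

Lemma lspan_sub H s : subspace H -> {in s, forall x, H x} -> lspan s `<=` H.
Proof.
move=> sH; elim: s => [|v s IH] sub x; first by move/lspan_nil->; exact: subspace0.
move=> /lspan_cons[a xs]; rewrite -(subrK (a *: v) x).
apply: subspaceD => //.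
  by apply: IH xs => y ys; apply: sub; rewrite inE ys orbT.
by apply: subspaceZ => //; apply: sub; rewrite mem_head.
Qed.

Lemma mem_lspan s x : x \in s -> lspan s x.
Proof.
elim: s => // v s IH; rewrite inE => /predU1P[->|/IH xs]; apply/lspan_cons.
  by exists 1; rewrite scale1r subrr; exact: subspace0 (subspace_lspan s).
by exists 0; rewrite scale0r subr0.
Qed.

Lemma lspan_mono s t : {subset s <= t} -> lspan s `<=` lspan t.
Proof.
by move=> st; apply: lspan_sub (subspace_lspan t) _ => x /st; exact: mem_lspan.
Qed.

(** Induction on the spanning list: [H] meets [lspan s] in a finite-dimensional
space, and one vector of [H] outside [lspan s] generates the rest of [H] over
this intersection, since [lspan (v :: s)] exceeds [lspan s] by at most
one dimension. *)
Lemma finite_dim_sub H s : subspace H -> H `<=` lspan s -> finite_dim H.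
Proof.
elim: s H => [|v s IH] H sH Hs.
  exists [::]; apply/seteqP; split=> // x /lspan_nil->; exact: subspace0.
have sHs := subspaceI sH (subspace_lspan s).
have [t Ht] : finite_dim (H `&` lspan s) by apply: IH => // x [].
have tH x : lspan t x -> H x by rewrite -Ht => -[].
have [Hs'|] := pselect (H `<=` lspan s).
  by exists t; rewrite -Ht; apply/esym/setIidPl.
move=> /existsNP[h /not_implyP[Hh hs]].
have /lspan_cons[c hc] := Hs h Hh.
have c0 : c != 0 by apply/eqP => c0; apply: hs; rewrite c0 scale0r subr0 in hc.
exists (h :: t); apply/seteqP; split=> x; last first.
  apply: (lspan_sub sH) => y; rewrite inE => /predU1P[->//|/mem_lspan]; exact: tH.
move=> Hx; have /lspan_cons[a xa] := Hs x Hx.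
apply/lspan_cons; exists (a / c); rewrite -Ht; split.
  by apply: subspaceB => //; exact: subspaceZ.
have -> : x - (a / c) *: h = (x - a *: v) - (a / c) *: (h - c *: v).
  by rewrite scalerBr scalerA divfK// opprB addrA subrK.
apply: subspaceB (subspace_lspan s) _ _ => //.
exact: subspaceZ (subspace_lspan s) _.
Qed.

Lemma lspan_rcons v s x : lspan (rcons s v) x <-> exists a, lspan s (x - a *: v).
Proof.
split=> [xs|/lspan_cons xs].
  apply/lspan_cons; apply: lspan_mono xs => y; by rewrite mem_rcons.
by apply: lspan_mono xs => y; rewrite mem_rcons.
Qed.

End Subspaces.

(** * Scalar and finitary endomorphisms *)

Section ScalarPlusFinitary.
Context (K : fieldType) (V : lmodType K).
Implicit Types (H W : set V) (s t : seq V) (a b k : K) (u v x y : V)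
  (f g : lend V).

Definition scalar_mult k : lend V := k \*: idfun.

Lemma scalar_multP k : scalar_mults V (scalar_mult k).
Proof. by exists k. Qed.

(** It is enough to cover the range by a finite span, as subspaces of
finite-dimensional spaces are finite-dimensional. *)
Lemma finitaryP f : finitary V f <-> exists s, forall v, lspan s (f v).
Proof.
split=> [[s fs]|[s fs]].
  by exists s => v; rewrite -fs; exists v.
apply: (@finite_dim_sub _ _ _ s); last by move=> _ [v _ <-].
exact/subspace_range/subspaceT.
Qed.

Lemma subring_scalar_mults : GRing.subring_closed (mem (scalar_mults V)).
Proof.
split=> [|f g /set_mem[k fk] /set_mem[l gl]|f g /set_mem[k fk] /set_mem[l gl]];
  apply: mem_set.
- by exists 1 => v; rewrite scale1r.
- by exists (k - l) => v; rewrite lend_addE lend_oppE fk gl scalerBl.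
- by exists (k * l) => v; rewrite lend_mulE fk gl scalerA.
Qed.

Lemma finitary0 : finitary V 0.
Proof. by apply/finitaryP; exists [::] => v; apply/lspan_nil. Qed.

Lemma finitaryB f g : finitary V f -> finitary V g -> finitary V (f - g).
Proof.
move=> /finitaryP[s fs] /finitaryP[t gt]; apply/finitaryP; exists (s ++ t) => v.
apply: subspaceB; first exact: subspace_lspan.
  by apply: lspan_mono (fs v) => x; rewrite mem_cat => ->.
by apply: lspan_mono (gt v) => x; rewrite mem_cat orbC => ->.
Qed.

Lemma finitaryD f g : finitary V f -> finitary V g -> finitary V (f + g).
Proof.
move=> ff fg; rewrite -[g]opprK -[- g]sub0r; apply: finitaryB => //.
exact: finitaryB finitary0 fg.
Qed.

Lemma finitaryMl f g : finitary V g -> finitary V (f * g).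
Proof.
move=> /finitaryP[s gs]; apply/finitaryP; exists (map f s) => v.
rewrite lend_mulE; move: (g v) (gs v) => {v}; elim: s {gs} => [|u s IH] x.
  by move/lspan_nil->; rewrite linear0; apply/lspan_nil.
move=> /lspan_cons[a /IH]; rewrite linearB linearZ /= => fx.
by apply/lspan_cons; exists a.
Qed.

Lemma finitaryMr f g : finitary V f -> finitary V (f * g).
Proof.
by move=> /finitaryP[s fs]; apply/finitaryP; exists s => v; exact: fs.
Qed.

Lemma rng_finitary : rng_closed (mem (finitary V)).
Proof.
split; first split; first exact/mem_set/finitary0.
  by move=> f g /set_mem ff /set_mem fg; apply/mem_set/finitaryB.
by move=> f g /set_mem ff _; apply/mem_set/finitaryMr.
Qed.

(** Products stay in the sum because finitary endomorphisms form a two-sided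
ideal: [(k + f) (l + g) = k l + (k g + f (l + g))]. *)
Lemma subring_scalar_add_finitary :
  GRing.subring_closed (mem (set_add (scalar_mults V) (finitary V))).
Proof.
have [s1 sB sM] := subring_scalar_mults.
split=> [|_ _ /set_mem[k sk [f ff <-]] /set_mem[l sl [g fg <-]]
         |_ _ /set_mem[k sk [f ff <-]] /set_mem[l sl [g fg <-]]]; apply: mem_set.
- by exists 1; [exact: set_mem|exists 0; [exact: finitary0|rewrite addr0]].
- exists (k - l); first by apply/set_mem/sB; exact: mem_set.
  by exists (f - g); [exact: finitaryB|rewrite opprD addrACA].
exists (k * l); first by apply/set_mem/sM; exact: mem_set.
exists (k * g + f * (l + g)); last by rewrite mulrDl [k * (l + g)]mulrDr addrA.
by apply: finitaryD; [exact: finitaryMl|exact: finitaryMr].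
Qed.

(** The scalar part maps [H] into itself, so [H + (k + g) H = H + g H]. *)
Lemma scalar_add_finitary_almost_preserving :
  set_add (scalar_mults V) (finitary V) `<=` almost_preserving V.
Proof.
move=> _ [k [a ka] [g /finitaryP[s gs] <-]] H sH.
have [t gHt] : finite_dim (g @` H).
  apply: (@finite_dim_sub _ _ _ s); first exact: subspace_range.
  by move=> _ [v _ <-].
exists t; rewrite -gHt; apply/seteqP; split=> _ [x Hx [_ [y Hy <-] <-]].
  exists (x + a *: y); first by apply: subspaceD => //; exact: subspaceZ.
  by exists (g y); [exists y|rewrite lend_addE ka addrA].
exists (x - a *: y); first by apply: subspaceB => //; exact: subspaceZ.
by exists ((k + g) y); [exists y|rewrite lend_addE ka addrA subrK].
Qed.

(** * Endomorphisms with every vector an eigenvector modulo a subspace *)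

(** The usual argument modulo [W]: if [c] is an eigenvalue for [v + u], then
[(b - c) v - (c - a) u] lies in [W], and independence of [u] and [v] modulo [W]
forces [b = c = a]. *)
Lemma eigenvalue_mod_unique W f a b u v : subspace W ->
    (forall x, ~ W x -> exists c, W (f x - c *: x)) ->
    ~ W u -> (forall c, ~ W (v - c *: u)) ->
  W (f u - a *: u) -> W (f v - b *: v) -> a = b.
Proof.
move=> sW eig Wu Wvu fu fv.
have [|c] := eig (v + u); first by move: (Wvu (-1)); rewrite scaleN1r opprK.
have -> : f (v + u) - c *: (v + u) =
    ((b - c) *: v - (c - a) *: u) + ((f v - b *: v) + (f u - a *: u)).
  rewrite linearD scalerDr opprD addrACA [in RHS]addrACA -scaleNr opprB.
  by congr (_ + _); rewrite [RHS]addrC scalerBl addrA subrK.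
move=> /(subspaceB sW) /(_ (subspaceD sW fv fu)); rewrite addrK => Wbc.
(* Otherwise [v] would be a multiple of [u] modulo [W]. *)
have [bc|bc] := eqVneq b c; last first.
  case: (Wvu ((c - a) / (b - c))); apply: (@subspaceZK _ _ _ (b - c)) => //.
    by rewrite subr_eq0.
  by rewrite scalerBr scalerA mulrC divfK // subr_eq0.
move: Wbc; rewrite bc subrr scale0r sub0r => /(subspaceZ (-1) sW).
rewrite scaleN1r opprK => Wca; apply/eqP; rewrite eq_sym -subr_eq0.
by apply/negP => /negP ca0; exact/Wu/(subspaceZK sW ca0).
Qed.

(** Without an escaping vector, every vector outside [W = lspan s] is an
eigenvector modulo [W]. If [V / W] has dimension at least 2, there are [v0] and
[v1] independent modulo [W], and every vector outside [W] has the eigenvalue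
[k] of [v0]. *)
Lemma scalar_add_finitary_or_escape f s :
  set_add (scalar_mults V) (finitary V) f \/
  exists v, ~ lspan s v /\ ~ lspan (v :: s) (f v).
Proof.
have sW := subspace_lspan s.
have [?|noesc] := pselect (exists v, ~ lspan s v /\ ~ lspan (v :: s) (f v)).
  by right.
left.
have eig v : ~ lspan s v -> exists c, lspan s (f v - c *: v).
  by move=> sv; apply/lspan_cons; apply: contrapT => fv; apply: noesc; exists v.
have fin t : (forall v, lspan t v) -> set_add (scalar_mults V) (finitary V) f.
  move=> tV; exists 0; first by exists 0 => v; rewrite scale0r.
  by exists f; rewrite ?add0r//; apply/finitaryP; exists t.
(* If [v0] or [v1] cannot be chosen, then [V] is finite-dimensional. *)
have [|/existsNP[v0 sv0]] := pselect (forall v, lspan s v); first exact: fin.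
have [|/existsNP[v1]] := pselect (forall v, lspan (v0 :: s) v); first exact: fin.
rewrite lspan_cons => /forallNP v1v0.
have [k fv0] := eig v0 sv0.
have fk u : ~ lspan s u -> lspan s (f u - k *: u).
  move=> su; have [a fu] := eig u su.
  suff -> : k = a by [].
  have [|/forallNP uv0] := pselect (exists c, lspan s (u - c *: v0)); last first.
    exact: eigenvalue_mod_unique uv0 fv0 fu.
  (* [u] is dependent on [v0] modulo [W], so the two cannot be compared directly;
     [v1], independent of each of them, serves as intermediary. *)
  move=> [c uc]; have sv1 : ~ lspan s v1.
    by move=> sv1; apply: (v1v0 0); rewrite scale0r subr0.
  have [b fv1] := eig v1 sv1.
  rewrite (eigenvalue_mod_unique sW eig sv0 v1v0 fv0 fv1).
  apply/esym/(eigenvalue_mod_unique sW eig su _ fu fv1) => d v1u.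
  apply: (v1v0 (d * c)).
  have -> : v1 - (d * c) *: v0 = (v1 - d *: u) + d *: (u - c *: v0).
    by rewrite scalerBr scalerA addrA subrK.
  by apply: subspaceD => //; exact: subspaceZ.
exists (scalar_mult k); first exact: scalar_multP.
exists (f - scalar_mult k); last by rewrite addrC subrK.
apply/finitaryP; exists s => v; rewrite lend_addE lend_oppE /=.
have [sv|/fk//] := pselect (lspan s v).
(* A vector [v] of [W] is the difference of [v + v0] and [v0], both outside [W]. *)
have sv' : ~ lspan s (v + v0).
  by move=> /(subspaceB sW)/(_ sv); rewrite addrC addKr.
have := subspaceB sW (fk _ sv') (fk _ sv0).
by rewrite linearD scalerDr opprD addrACA addrK.
Qed.

(** * The infinite independent family *)

(** Starting from [W_0 = 0], choose [w_n] escaping from [W_n] and put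
[W_(n+1) = W_n + K w_n + K f(w_n)]; let [H] be the span of all the [w_n]. If
finitely many vectors [t] spanned [H + f H] over [H], they would lie in some
[W_n], so that [f (w_n) = h + y] with [h] in [H] and [y] in [W_n]. But [h] then
lies in [W_(n+1)], and [H] meets [W_(n+1)] inside [W_n + K w_n]; this puts
[f (w_n)] in [W_n + K w_n], contrary to the choice of [w_n]. *)
Lemma escape_not_almost_preserving f :
  (forall s, exists v, ~ lspan s v /\ ~ lspan (v :: s) (f v)) ->
  ~ almost_preserving V f.
Proof.
move=> /choice[p /all_and2[pP fpP]] fH.
pose W := fix W n := if n is m.+1 then f (p (W m)) :: p (W m) :: W m else [::].
pose w n := p (W n).
pose H : set V := [set x | exists n, lspan (mkseq w n) x].
have W_mono m n : (m <= n)%N -> lspan (W m) `<=` lspan (W n).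
  elim: n => [|n IH]; first by rewrite leqn0 => /eqP->.
  rewrite leq_eqVlt => /predU1P[->//|/IH mn]; apply: subset_trans mn _.
  by apply: lspan_mono => x xW; rewrite /= !inE xW !orbT.
have wW n : lspan (W n.+1) (w n) by apply: mem_lspan; rewrite !inE eqxx orbT.
have fwW n : lspan (W n.+1) (f (w n)) by apply: mem_lspan; rewrite !inE eqxx.
have mkW n : lspan (mkseq w n) `<=` lspan (W n).
  apply: lspan_sub => [|x /mapP[i]]; first exact: subspace_lspan.
  by rewrite mem_iota add0n => /= lt_in ->; exact: (W_mono i.+1 n lt_in _ (wW i)).
have fmkW n x : lspan (mkseq w n) x -> lspan (W n) (f x).
  elim: n x => [x /lspan_nil->|n IH x].
    by rewrite linear0; apply/lspan_nil.
  rewrite mkseqS => /lspan_rcons[a /IH fx].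
  rewrite -(subrK (a *: w n) x) linearD; apply: subspaceD.
  - exact: subspace_lspan.
  - exact: W_mono _ _ (leqnSn n) _ fx.
  - rewrite linearZ; apply: subspaceZ (fwW n); exact: subspace_lspan.
have mk_mono m n : (m <= n)%N -> lspan (mkseq w m) `<=` lspan (mkseq w n).
  move=> le_mn; apply: lspan_mono => x /mapP[i]; rewrite mem_iota => /= lt_im ->.
  by apply: map_f; rewrite mem_iota /= (leq_trans lt_im).
have sH : subspace H.
  apply/subspaceP; split; first by exists 0; apply/lspan_nil.
  move=> a x y [m xm] [n yn]; exists (maxn m n).
  have sm := subspace_lspan (mkseq w (maxn m n)).
  apply: (subspaceD sm); last exact: mk_mono _ _ (leq_maxr m n) _ yn.
  by apply: (subspaceZ _ sm); exact: mk_mono _ _ (leq_maxl m n) _ xm.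
have [t Ht] := fH H sH.
(* [H + f H] is the increasing union of its intersections with the [W_n], so the
   finite list [t] lies in one [W_n]. *)
have [n tn] : exists n, {in t, forall x, lspan (W n) x}.
  have : {in t, forall x, exists n, lspan (W n) x}.
    move=> x xt; have : set_add H (f @` H) x.
      rewrite Ht; exists 0; first exact: subspace0.
      by exists x; [exact: mem_lspan|rewrite add0r].
    move=> [y [m ym] [_ [z [l zl] <-] <-]]; exists (maxn m l).
    apply: subspaceD; first exact: subspace_lspan.
      exact/(W_mono _ _ (leq_maxl m l))/mkW.
    exact/(W_mono _ _ (leq_maxr m l))/fmkW.
  elim: (t) => [|x r IH] rW; first by exists 0%N.
  have [m mr] : exists n, {in r, forall x, lspan (W n) x}.
    by apply: IH => y yr; apply: rW; rewrite inE yr orbT.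
  have [l xl] := rW x (mem_head x r).
  exists (maxn m l) => y; rewrite inE => /predU1P[->|/mr yr].
    exact: W_mono _ _ (leq_maxr m l) _ xl.
  exact: W_mono _ _ (leq_maxl m l) _ yr.
(* In an element of [H] lying in [W_(n+1)], the coefficient of each [w_N] with
   [N > n] vanishes, as [w_N] is not in [W_N]; drop these terms one by one. *)
have trace N h : lspan (mkseq w N) h -> lspan (W n.+1) h -> lspan (w n :: W n) h.
  elim: N h => [h /lspan_nil-> _|N IH h hN hn].
    exact: subspace0 (subspace_lspan _).
  have [lt_nN|le_Nn] := ltnP n N; last first.
    have : lspan (w n :: mkseq w n) h.
      apply: lspan_mono (mk_mono N.+1 n.+1 le_Nn h hN) => x.
      by rewrite mkseqS mem_rcons.
    move=> /lspan_cons[a ha]; apply/lspan_cons; exists a; exact: mkW.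
  move: hN; rewrite mkseqS => /lspan_rcons[a ha].
  have [a0|a0] := eqVneq a 0.
    by move: ha; rewrite a0 scale0r subr0 => /IH; exact.
  have sWN := subspace_lspan (W N).
  case: (pP (W N)); apply: (subspaceZK sWN a0).
  have -> : a *: p (W N) = h - (h - a *: w N) by rewrite opprB addrC subrK.
  by apply: subspaceB sWN _ _; [exact: (W_mono n.+1 N lt_nN _ hn)|exact: mkW].
have : set_add H (f @` H) (f (w n)).
  exists 0; first exact: subspace0.
  exists (f (w n)); last by rewrite add0r.
  by exists (w n) => //; exists n.+1; rewrite mkseqS; apply: mem_lspan;
    rewrite mem_rcons mem_head.
rewrite Ht => -[h [N hN] [y ty hy]].
have yn : lspan (W n) y by apply: lspan_sub tn _ ty; exact: subspace_lspan.
apply: (fpP (W n)); rewrite -/(w n) -hy; apply: subspaceD.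
- exact: subspace_lspan.
- apply: (trace N) => //.
  rewrite -(addrK y h) hy; apply: subspaceB; first exact: subspace_lspan.
    exact: fwW.
  exact: W_mono _ _ (leqnSn n) _ yn.
- by apply: lspan_mono yn => x xn; rewrite inE xn orbT.
Qed.

Lemma almost_preservingE :
  almost_preserving V = set_add (scalar_mults V) (finitary V).
Proof.
apply/seteqP; split; last exact: scalar_add_finitary_almost_preserving.
move=> f fP; apply: contrapT => nf.
apply: (escape_not_almost_preserving _ fP) => s.
by have [] := scalar_add_finitary_or_escape f s.
Qed.

End ScalarPlusFinitary.

Theorem corollary1 (K : fieldType) (V : lmodType K) :
  [/\ GRing.subring_closed (mem (almost_preserving V)),
      GRing.subring_closed (mem (scalar_mults V)),
      rng_closed (mem (finitary V))
    & almost_preserving V = set_add (scalar_mults V) (finitary V)].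
Proof.
split.
- by rewrite almost_preservingE; exact: subring_scalar_add_finitary.
- exact: subring_scalar_mults.
- exact: rng_finitary.
- exact: almost_preservingE.
Qed.
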